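(* If $k$ is a perfect field and $\Lambda$ is a finite dimensional basic $k$-algebra, then $\Lambda$ is $\mathfrak{r}$-split.
   Context: $\mathfrak{r} = \operatorname{rad}\Lambda$ is the Jacobson radical. $\Lambda$ is basic if ${}_\Lambda\Lambda$ is a direct sum of pairwise non-isomorphic indecomposable projective left modules. Let $\pi\colon \Lambda \to \Lambda/\mathfrak{r}$ be the natural projection. $\Lambda$ is split if there is a $k$-algebra homomorphism $\epsilon\colon \Lambda/\mathfrak{r} \to \Lambda$ with $\pi\epsilon = \operatorname{id}_{\Lambda/\mathfrak{r}}$. A split algebra $\Lambda$ is $\mathfrak{r}$-split if for any such $\epsilon$ the short exact sequence $0 \to \mathfrak{r}^2 \to \mathfrak{r} \to \mathfrak{r}/\mathfrak{r}^2 \to 0$ splits as a sequence of $\Lambda/\mathfrak{r}$-$\Lambda/\mathfrak{r}$-bimodules, the bimodule structures being given via $\epsilon$. *)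

(* Defs.v *)
From HB Require Import structures.
From mathcomp Require Import all_boot all_order all_algebra all_field.
From mathcomp Require Import boolp.

Set Implicit Arguments.
Unset Strict Implicit.
Unset Printing Implicit Defensive.

Import GRing.Theory.
Local Open Scope ring_scope.
Local Open Scope quotient_scope.

Definition perfect (k : fieldType) :=
  forall p : {poly k}, irreducible_poly p -> separable_poly p.

Section Modules.

Variable R : nzRingType.

Definition lmod_iso (M N : lmodType R) := exists f : {linear M -> N}, bijective f.

Definition projective (P : lmodType R) :=
  forall (M N : lmodType R) (g : {linear M -> N}) (f : {linear P -> N}),
    (forall y, exists x, g x = y) ->
  exists h : {linear P -> M}, forall x, g (h x) = f x.

Definition indecomposable (P : lmodType R) :=
  (exists x : P, x != 0) /\
  forall X Y : lmodType R, lmod_iso P (X * Y)%type ->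
    (forall x : X, x = 0) \/ (forall y : Y, y = 0).

(* The f i are the structure maps P i -> M of the coproduct. *)
Definition is_direct_sum (M : lmodType R) (n : nat) (P : 'I_n -> lmodType R) :=
  exists f : forall i, {linear P i -> M},
    (forall x : M, exists y : forall i, P i, x = \sum_i f i (y i)) /\
    (forall y : forall i, P i, \sum_i f i (y i) = 0 -> forall i, y i = 0).

End Modules.

(* A^o is the regular left module of A. *)
Definition basic (k : fieldType) (A : falgType k) :=
  exists (n : nat) (P : 'I_n -> lmodType A),
    [/\ is_direct_sum A^o P,
        forall i, indecomposable (P i),
        forall i, projective (P i) &
        forall i j, i != j -> ~ lmod_iso (P i) (P j)].

Section Bimodules.

Variables S T : nzRingType.

Record bimodule := Bimodule {
  bimod_sort :> zmodType;
  lact : S -> bimod_sort -> bimod_sort;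
  ract : bimod_sort -> T -> bimod_sort;
  lact1 : forall x, lact 1 x = x;
  lactM : forall a b x, lact (a * b) x = lact a (lact b x);
  lactDl : forall a b x, lact (a + b) x = lact a x + lact b x;
  lactDr : forall a x y, lact a (x + y) = lact a x + lact a y;
  ract1 : forall x, ract x 1 = x;
  ractM : forall x a b, ract x (a * b) = ract (ract x a) b;
  ractDr : forall x a b, ract x (a + b) = ract x a + ract x b;
  ractDl : forall x y a, ract (x + y) a = ract x a + ract y a;
  lractA : forall a x b, ract (lact a x) b = lact a (ract x b)
}.

(* No k-linearity is required: when S and T are k-algebras acting compatibly with
   k, as below, it follows from commutation with the actions of c *: 1. *)
Definition bimod_hom (M N : bimodule) (f : M -> N) :=
  [/\ forall x y, f (x + y) = f x + f y,
      forall a x, f (lact a x) = lact a (f x) &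
      forall x b, f (ract x b) = ract (f x) b].

Definition short_exact (L M N : bimodule) (i : L -> M) (p : M -> N) :=
  [/\ bimod_hom i, bimod_hom p, injective i,
      forall x, p x = 0 <-> exists y, i y = x &
      forall z, exists x, p x = z].

Definition ses_splits (L M N : bimodule) (i : L -> M) (p : M -> N) :=
  short_exact i p /\ exists2 s : N -> M, bimod_hom s & cancel s p.

End Bimodules.

Section JacobsonRadical.

Variables (k : fieldType) (A : falgType k).
Implicit Types (M N U : {vspace A}) (a x y : A).

(* A is a unital k-algebra, so every left ideal is a k-subspace. *)
Definition left_ideal M := (fullv * M <= M)%VS.

Definition maximal_left_ideal M :=
  [/\ left_ideal M, M != fullv &
      forall N, left_ideal N -> (M <= N)%VS -> N = M \/ N = fullv].

Lemma left_idealP M :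
  reflect (forall a x, x \in M -> a * x \in M) (left_ideal M).
Proof.
apply: (iffP prodvP) => [h a x xM|h a x _]; last exact: h.
by apply: h; rewrite ?memvf.
Qed.

(* An intersection of subspaces of A, finitely many of which suffice. *)
Lemma jrad_exists :
  exists J : {vspace A},
    forall x, x \in J <-> forall M, maximal_left_ideal M -> x \in M.
Proof.
pose Q U := forall x, (forall M, maximal_left_ideal M -> x \in M) -> x \in U.
have exQ : exists n, `[< exists2 U, Q U & \dim U = n >].
  exists (\dim {:A}); apply/asboolP; exists fullv => // x _.
  by rewrite memvf.
case: (ex_minnP exQ) => n /asboolP [J QJ dJ] minJ.
exists J => x; split=> [xJ M maxM|]; last exact: QJ.
suff /eqP JM : (J :&: M == J)%VS by move: xJ; rewrite -JM memv_cap => /andP [].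
rewrite -(geq_leqif (dimv_leqif_eq (capvSl J M))) dJ; apply: minJ.
apply/asboolP; exists (J :&: M)%VS => // y hy.
by rewrite memv_cap QJ //= hy.
Qed.

Definition jrad : {vspace A} := sval (cid jrad_exists).

Lemma jradP x : x \in jrad <-> forall M, maximal_left_ideal M -> x \in M.
Proof. exact: svalP (cid jrad_exists) x. Qed.

Lemma jradMl a x : x \in jrad -> a * x \in jrad.
Proof.
move/jradP=> xJ; apply/jradP => M maxM.
by have [/left_idealP idM _ _] := maxM; apply/idM/xJ.
Qed.

(* If a \notin M, then (M : a) = {y | y * a \in M} is again a maximal left
   ideal. *)
Lemma jradMr a x : x \in jrad -> x * a \in jrad.
Proof.
move/jradP=> xJ; apply/jradP => M maxM.
have [/left_idealP idM _ topM] := maxM.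
have [aM|aNM] := boolP (a \in M); first exact: idM.
pose Ma := (amulr a @^-1: M)%VS.
have MaE y : (y \in Ma) = (y * a \in M) by rewrite -memv_preim lfunE.
rewrite -MaE; apply: xJ; split.
- by apply/left_idealP => b y; rewrite !MaE -mulrA; apply: idM.
- by apply: contraNneq aNM => Mafull; rewrite -[a]mul1r -MaE Mafull memvf.
move=> N idN MaN; move: (idN) => /left_idealP idNP.
have [NMa|] := boolP (N <= Ma)%VS; first by left; apply/eqP; rewrite eqEsubv NMa.
case/subvPn => n nN; rewrite MaE => naNM; right.
have idP : left_ideal (M + amulr (n * a) @: fullv)%VS.
  apply/left_idealP => b _ /memv_addP [m mM [_ /memv_imgP [c _ ->] ->]].
  rewrite mulrDr memv_add ?idM //; apply/memv_imgP; exists (b * c) => //.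
    by rewrite memvf.
  by rewrite !lfunE /= mulrA.
have naP : n * a \in (M + amulr (n * a) @: fullv)%VS.
  rewrite -[X in X \in _]add0r memv_add ?mem0v //; apply/memv_imgP; exists 1.
    by rewrite memvf.
  by rewrite lfunE /= mul1r.
case: (topM _ idP (addvSl _ _)) => [PM|Pfull].
  by rewrite -PM naP in naNM.
have : a \in (M + amulr (n * a) @: fullv)%VS by rewrite Pfull memvf.
case/memv_addP=> m mM [_ /memv_imgP [c _ ->]]; rewrite lfunE /= mulrA => am.
have oneN : 1 \in N.
  rewrite -[1](subrK (c * n)) rpredD ?idNP //; apply: (subvP MaN).
  by rewrite MaE mulrBl mul1r {1}am addrK.
by apply/eqP; rewrite eqEsubv subvf; apply/subvP => y _; rewrite -[y]mulr1 idNP.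
Qed.

Lemma jrad_proper : 1 \notin jrad.
Proof.
pose Q n := `[< exists U, [/\ left_ideal U, U != fullv & \dim U = n] >].
have exQ : exists n, Q n.
  exists 0%N; apply/asboolP; exists 0%VS; rewrite dimv0; split=> //.
    by rewrite /left_ideal prodv0 subvv.
  by apply: contraTneq (memvf (1 : A)) => <-; rewrite memv0 oner_neq0.
have boundQ n : Q n -> (n <= \dim {:A})%N.
  by move/asboolP=> [U [_ _ <-]]; rewrite dimvS ?subvf.
case: (ex_maxnP exQ boundQ) => n /asboolP [M [idM Mfull dM]] maxQ.
have maxM : maximal_left_ideal M.
  split=> // N idN MN; have [->|Nfull] := eqVneq N fullv; first by right.
  left; apply/esym/eqP; rewrite -(geq_leqif (dimv_leqif_eq MN)) dM.
  by apply: maxQ; apply/asboolP; exists N.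
apply/negP => /jradP /(_ M maxM) oneM; move/negP: Mfull; apply.
rewrite eqEsubv subvf; apply/subvP => y _; rewrite -[y]mulr1.
by move/left_idealP: idM; apply.
Qed.

Definition two_sided_ideal U := (fullv * U <= U)%VS && (U * fullv <= U)%VS.

Lemma two_sided_idealMl U a x : two_sided_ideal U -> x \in U -> a * x \in U.
Proof. by case/andP=> /prodvP idU _ xU; apply: idU; rewrite ?memvf. Qed.

Lemma two_sided_idealMr U a x : two_sided_ideal U -> x \in U -> x * a \in U.
Proof. by case/andP=> _ /prodvP idU xU; apply: idU; rewrite ?memvf. Qed.

Lemma jrad_ideal : two_sided_ideal jrad.
Proof.
by apply/andP; split; apply/prodvP => x y; [move=> _ /jradMl | move=> /jradMr].
Qed.

Lemma jrad2_ideal : two_sided_ideal (jrad ^+ 2)%VS.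
Proof.
have /andP [idl idr] := jrad_ideal.
by rewrite /two_sided_ideal expv2 prodvA prodvSl //= -prodvA prodvSr.
Qed.

End JacobsonRadical.

Section RadicalQuotient.

Variables (k : fieldType) (A : falgType k).

Definition jquot := {ideal_quot (jrad A)}.

HB.instance Definition _ := GRing.Zmodule.on jquot.

Definition jproj (x : A) : jquot := \pi_jquot x.

Lemma jproj_eq x y : jproj x = jproj y <-> x - y \in jrad A.
Proof.
have -> : (x - y \in jrad A) = (jproj x == jproj y).
  exact: (Quotient.idealrBE (jrad A)).
by split=> [->|/eqP].
Qed.

Lemma jproj_repr (u : jquot) : jproj (repr u) = u.
Proof. exact: reprK. Qed.

Lemma jproj_repr_sub x : repr (jproj x) - x \in jrad A.
Proof. by apply/jproj_eq; rewrite jproj_repr. Qed.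

Fact jproj_is_zmod_morphism : zmod_morphism jproj.
Proof. exact: raddfB. Qed.
HB.instance Definition _ :=
  GRing.isZmodMorphism.Build A jquot jproj jproj_is_zmod_morphism.

Lemma jprojD x y : jproj (x + y) = jproj x + jproj y.
Proof. exact: raddfD. Qed.

Lemma jquotW (P : jquot -> Prop) : (forall x, P (jproj x)) -> forall u, P u.
Proof. by move=> Pproj u; rewrite -[u]jproj_repr. Qed.

Definition jquot_one : jquot := jproj 1.
Definition jquot_mul (u v : jquot) : jquot := jproj (repr u * repr v).
Definition jquot_scale (c : k) (u : jquot) : jquot := jproj (c *: repr u).

Lemma jproj_mul x y : jproj (x * y) = jquot_mul (jproj x) (jproj y).
Proof.
apply/esym/jproj_eq; set u := repr _; set v := repr _.
have -> : u * v - x * y = (u - x) * v + x * (v - y).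
  by rewrite mulrBl mulrBr addrA subrK.
by apply: rpredD; [apply: jradMr | apply: jradMl]; apply: jproj_repr_sub.
Qed.

Lemma jproj_scale c x : jproj (c *: x) = jquot_scale c (jproj x).
Proof. by apply/esym/jproj_eq; rewrite -scalerBr memvZ ?jproj_repr_sub. Qed.

Lemma jquot_mulA : associative jquot_mul.
Proof.
elim/jquotW=> x; elim/jquotW=> y; elim/jquotW=> z.
by rewrite -!jproj_mul mulrA.
Qed.

Lemma jquot_mul1 : left_id jquot_one jquot_mul.
Proof. by elim/jquotW=> x; rewrite -jproj_mul mul1r. Qed.

Lemma jquot_mulr1 : right_id jquot_one jquot_mul.
Proof. by elim/jquotW=> x; rewrite -jproj_mul mulr1. Qed.

Lemma jquot_mulDl : left_distributive jquot_mul +%R.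
Proof.
elim/jquotW=> x; elim/jquotW=> y; elim/jquotW=> z.
by rewrite -jprojD -!jproj_mul -jprojD mulrDl.
Qed.

Lemma jquot_mulDr : right_distributive jquot_mul +%R.
Proof.
elim/jquotW=> x; elim/jquotW=> y; elim/jquotW=> z.
by rewrite -jprojD -!jproj_mul -jprojD mulrDr.
Qed.

Lemma jquot_one_neq0 : jquot_one != 0.
Proof.
apply/eqP; rewrite -(raddf0 jproj) => /jproj_eq.
by rewrite subr0 (negPf (jrad_proper A)).
Qed.

HB.instance Definition _ := GRing.Zmodule_isNzRing.Build jquot
  jquot_mulA jquot_mul1 jquot_mulr1 jquot_mulDl jquot_mulDr jquot_one_neq0.

Lemma jquot_scaleA c d u : jquot_scale c (jquot_scale d u) = jquot_scale (c * d) u.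
Proof. by elim/jquotW: u => x; rewrite -!jproj_scale scalerA. Qed.

Lemma jquot_scale1 : left_id 1 jquot_scale.
Proof. by elim/jquotW=> x; rewrite -jproj_scale scale1r. Qed.

Lemma jquot_scaleDr : right_distributive jquot_scale +%R.
Proof.
move=> c; elim/jquotW=> x; elim/jquotW=> y.
by rewrite -jprojD -!jproj_scale -jprojD scalerDr.
Qed.

Lemma jquot_scaleDl u : {morph jquot_scale^~ u : c d / c + d}.
Proof.
by move=> c d; elim/jquotW: u => x; rewrite -!jproj_scale -jprojD scalerDl.
Qed.

HB.instance Definition _ := GRing.Zmodule_isLmodule.Build k jquot
  jquot_scaleA jquot_scale1 jquot_scaleDr jquot_scaleDl.

Lemma jquot_scaleAl (c : k) (u v : jquot) : c *: (u * v) = (c *: u) * v.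
Proof.
elim/jquotW: u => x; elim/jquotW: v => y.
by rewrite -[LHS]/(jquot_scale _ (jquot_mul _ _)) -[RHS]/(jquot_mul (jquot_scale _ _) _)
  -!(jproj_scale, jproj_mul) scalerAl.
Qed.

Lemma jquot_scaleAr (c : k) (u v : jquot) : c *: (u * v) = u * (c *: v).
Proof.
elim/jquotW: u => x; elim/jquotW: v => y.
by rewrite -[LHS]/(jquot_scale _ (jquot_mul _ _)) -[RHS]/(jquot_mul _ (jquot_scale _ _))
  -!(jproj_scale, jproj_mul) scalerAr.
Qed.

HB.instance Definition _ := GRing.Lmodule_isLalgebra.Build k jquot jquot_scaleAl.
HB.instance Definition _ := GRing.Lalgebra_isAlgebra.Build k jquot jquot_scaleAr.

Fact jproj_is_monoid_morphism : monoid_morphism jproj.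
Proof. by split=> // x y; rewrite jproj_mul. Qed.
HB.instance Definition _ :=
  GRing.isMonoidMorphism.Build A jquot jproj jproj_is_monoid_morphism.

Fact jproj_is_scalable : scalable jproj.
Proof. by move=> c x; rewrite jproj_scale. Qed.
HB.instance Definition _ :=
  GRing.isScalable.Build k A jquot *:%R jproj jproj_is_scalable.

End RadicalQuotient.

Section IdealBimodules.

Variables (k : fieldType) (A : falgType k) (S : nzRingType).
Variable eps : {rmorphism S -> A}.

(* The S-S-bimodule a . x . b = eps a * x * eps b on a two-sided ideal I of A. *)
Section Ideal.

Variables (I : {vspace A}) (idI : two_sided_ideal I).

Definition ideal_lact (a : S) (x : subvs_of I) : subvs_of I :=
  Subvs (two_sided_idealMl (eps a) idI (subvsP x)).

Definition ideal_ract (x : subvs_of I) (b : S) : subvs_of I :=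
  Subvs (two_sided_idealMr (eps b) idI (subvsP x)).

Definition ideal_bimod : bimodule S S.
Proof.
refine (@Bimodule S S (subvs_of I) ideal_lact ideal_ract _ _ _ _ _ _ _ _ _).
all: try by (intros; apply: val_inj;
  rewrite /= ?(rmorph1, rmorphM, rmorphD) /= ?(mul1r, mulr1, mulrA, mulrDl, mulrDr)).
Defined.

End Ideal.

(* For two-sided ideals J <= I: the inclusion of J into I and the projection of I
   onto I / J. *)
Section Quotient.

Variables (I J : {vspace A}).
Hypothesis idI : two_sided_ideal I.
Hypothesis idJ : two_sided_ideal J.
Hypothesis sJI : (J <= I)%VS.

Definition ideal_incl (x : subvs_of J) : subvs_of I :=
  Subvs (subvP sJI _ (subvsP x)).

Definition subideal : {vspace subvs_of I} := (linfun vsval @^-1: J)%VS.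

Lemma mem_subideal x : (x \in subideal) = (vsval x \in J).
Proof. by rewrite -memv_preim lfunE. Qed.

Definition ideal_quo := {ideal_quot subideal}.

HB.instance Definition _ := GRing.Zmodule.on ideal_quo.

Definition ideal_proj (x : subvs_of I) : ideal_quo := \pi_ideal_quo x.

Fact ideal_proj_is_zmod_morphism : zmod_morphism ideal_proj.
Proof. exact: raddfB. Qed.
HB.instance Definition _ :=
  GRing.isZmodMorphism.Build (subvs_of I) ideal_quo ideal_proj
    ideal_proj_is_zmod_morphism.

Lemma ideal_proj_eq x y :
  ideal_proj x = ideal_proj y <-> vsval x - vsval y \in J.
Proof.
have -> : (vsval x - vsval y \in J) = (ideal_proj x == ideal_proj y).
  by rewrite -raddfB -mem_subideal; apply: (Quotient.idealrBE subideal).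
by split=> [->|/eqP].
Qed.

Lemma ideal_proj_repr (u : ideal_quo) : ideal_proj (repr u) = u.
Proof. exact: reprK. Qed.

Lemma ideal_projD x y : ideal_proj (x + y) = ideal_proj x + ideal_proj y.
Proof. exact: raddfD. Qed.

Lemma ideal_quoW (P : ideal_quo -> Prop) :
  (forall x, P (ideal_proj x)) -> forall u, P u.
Proof. by move=> Pproj u; rewrite -[u]ideal_proj_repr. Qed.

Definition quo_lact (a : S) (u : ideal_quo) : ideal_quo :=
  ideal_proj (ideal_lact idI a (repr u)).

Definition quo_ract (u : ideal_quo) (b : S) : ideal_quo :=
  ideal_proj (ideal_ract idI (repr u) b).

Lemma ideal_proj_lact a x :
  ideal_proj (ideal_lact idI a x) = quo_lact a (ideal_proj x).
Proof.
apply/esym/ideal_proj_eq; rewrite /= -mulrBr two_sided_idealMl //.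
by apply/ideal_proj_eq; rewrite ideal_proj_repr.
Qed.

Lemma ideal_proj_ract x b :
  ideal_proj (ideal_ract idI x b) = quo_ract (ideal_proj x) b.
Proof.
apply/esym/ideal_proj_eq; rewrite /= -mulrBl two_sided_idealMr //.
by apply/ideal_proj_eq; rewrite ideal_proj_repr.
Qed.

Definition quo_bimod : bimodule S S.
Proof.
pose B := ideal_bimod idI.
refine (@Bimodule S S ideal_quo quo_lact quo_ract _ _ _ _ _ _ _ _ _).
- elim/ideal_quoW=> x; rewrite -ideal_proj_lact.
  exact: (congr1 ideal_proj (@lact1 _ _ B x)).
- move=> a b; elim/ideal_quoW=> x; rewrite -!ideal_proj_lact.
  exact: (congr1 ideal_proj (@lactM _ _ B a b x)).
- move=> a b; elim/ideal_quoW=> x; rewrite -!ideal_proj_lact -ideal_projD.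
  exact: (congr1 ideal_proj (@lactDl _ _ B a b x)).
- move=> a; elim/ideal_quoW=> x; elim/ideal_quoW=> y.
  rewrite -ideal_projD -!ideal_proj_lact -ideal_projD.
  exact: (congr1 ideal_proj (@lactDr _ _ B a x y)).
- elim/ideal_quoW=> x; rewrite -ideal_proj_ract.
  exact: (congr1 ideal_proj (@ract1 _ _ B x)).
- elim/ideal_quoW=> x a b; rewrite -!ideal_proj_ract.
  exact: (congr1 ideal_proj (@ractM _ _ B x a b)).
- elim/ideal_quoW=> x a b; rewrite -!ideal_proj_ract -ideal_projD.
  exact: (congr1 ideal_proj (@ractDr _ _ B x a b)).
- elim/ideal_quoW=> x; elim/ideal_quoW=> y a.
  rewrite -ideal_projD -!ideal_proj_ract -ideal_projD.
  exact: (congr1 ideal_proj (@ractDl _ _ B x y a)).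
- move=> a; elim/ideal_quoW=> x b.
  rewrite -ideal_proj_lact -!ideal_proj_ract -ideal_proj_lact.
  exact: (congr1 ideal_proj (@lractA _ _ B a x b)).
Defined.

Lemma ideal_short_exact :
  @short_exact S S (ideal_bimod idJ) (ideal_bimod idI) quo_bimod
    ideal_incl ideal_proj.
Proof.
split.
- by split=> *; apply: val_inj.
- split=> *; [exact: ideal_projD | exact: ideal_proj_lact |].
  exact: ideal_proj_ract.
- by move=> x y /(congr1 vsval) xy; apply: val_inj.
- move=> x; have -> : 0 = ideal_proj 0 by rewrite raddf0.
  have -> : ideal_proj x = ideal_proj 0 <-> vsval x \in J.
    by rewrite ideal_proj_eq (raddf0 vsval) subr0.
  split=> [xJ|[y <-]]; last exact: (subvsP (y : subvs_of J)).
  by exists (Subvs xJ); apply: val_inj.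
- by move=> z; exists (repr z); apply: ideal_proj_repr.
Qed.

End Quotient.

End IdealBimodules.

Section RadicalSplit.

Variables (k : fieldType) (A : falgType k).

Definition alg_section (eps : {lrmorphism jquot A -> A}) :=
  forall u, jproj (eps u) = u.

Definition split_algebra := exists eps : {lrmorphism jquot A -> A}, alg_section eps.

Lemma jrad2_sub : (jrad A ^+ 2 <= jrad A)%VS.
Proof. by apply/prodvP => x y _ /jradMl. Qed.

(* The sequence 0 -> r^2 -> r -> r/r^2 -> 0 of (A/r)-(A/r)-bimodules given by eps;
   its exactness is rad_short_exact. *)
Section RadicalSequence.

Variable eps : {lrmorphism jquot A -> A}.

Definition rad2_bimod := ideal_bimod eps (jrad2_ideal A).
Definition rad_bimod := ideal_bimod eps (jrad_ideal A).
Definition rad_quo_bimod := quo_bimod eps (jrad_ideal A) (jrad2_ideal A).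

Definition rad2_incl : rad2_bimod -> rad_bimod := ideal_incl jrad2_sub.
Definition rad_proj : rad_bimod -> rad_quo_bimod :=
  @ideal_proj k A (jrad A) (jrad A ^+ 2)%VS.

Lemma rad_short_exact : short_exact rad2_incl rad_proj.
Proof. exact: ideal_short_exact. Qed.

End RadicalSequence.

Definition rad_split :=
  split_algebra /\
  forall eps : {lrmorphism jquot A -> A}, alg_section eps ->
    ses_splits (rad2_incl (eps := eps)) (rad_proj (eps := eps)).

End RadicalSplit.

(* Main.v *)
(** Over a perfect field every semiprime finite-dimensional algebra S has a
separability idempotent e in S (x) S, that is, m(e) = 1 for the multiplication m
and s e = e s for all s in S. For S = A / rad A, e corrects a
linear section of the projection to a multiplicative one modulo higher and higher
powers of rad A (the vanishing of the second Hochschild cohomology), and averaging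
over e on both sides makes a linear section of rad A -> rad A / rad^2 A a bimodule
map.

To find e, let Z be the center of S. Every element of Z has a separable
annihilating polynomial, so Z has a separability idempotent c. The multiplication
algebra M of S (the maps x |-> sum a x b) is semiprime, so its left ideal
{w | w 1 = 0} is generated by an idempotent f, and 1 - f maps S to Z and fixes 1.
Write 1 - f as x |-> sum p x q and put e = sum p c q: as c kills the kernel of
S (x) S^op -> M, centrality of sum p x q gives s e = e s. *)

Require Import Defs.
From HB Require Import structures.
From mathcomp Require Import all_boot all_order all_algebra all_field.
From mathcomp Require Import boolp.

Set Implicit Arguments.
Unset Strict Implicit.
Unset Printing Implicit Defensive.

Import GRing.Theory.
Local Open Scope ring_scope.

(** A subspace of largest dimension inside [P] contains every [x] with [P x], since otherwise adding
    the line of [x] would enlarge it. Existential predicates thereby become subspaces. *)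
Lemma vspace_of_pred (k : fieldType) (V : vectType k) (P : V -> Prop) :
  P 0 -> (forall (c : k) x y, P x -> P y -> P (c *: x + y)) ->
  exists U : {vspace V}, forall x, x \in U <-> P x.
Proof.
move=> P0 Plin.
pose Q n := `[< exists U : {vspace V}, (forall x, x \in U -> P x) /\ \dim U = n >].
have exQ : exists n, Q n.
  exists 0%N; apply/asboolP; exists 0%VS; rewrite dimv0; split=> // x.
  by rewrite memv0 => /eqP ->.
have boundQ n : Q n -> (n <= \dim {:V})%N.
  by move/asboolP=> [U [_ <-]]; rewrite dimvS ?subvf.
case: (ex_maxnP exQ boundQ) => n /asboolP [U [UP dU]] maxQ.
exists U => x; split=> [|Px]; first exact: UP.
suff /eqP -> : (U == <[x]> + U)%VS by rewrite memvE addvSl.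
rewrite -(geq_leqif (dimv_leqif_eq (addvSr _ _))) dU; apply: maxQ.
apply/asboolP; exists (<[x]> + U)%VS; split=> // y.
by case/memv_addP=> _ /vlineP [c ->] [u uU ->]; apply: Plin => //; apply: UP.
Qed.

(** * Idempotents in semiprime algebras *)

Section IdempotentGenerator.

Variables (k : fieldType) (E : falgType k) (M : {vspace E}).
Implicit Types L K : {vspace E}.

(** [M] stands for the ambient algebra: it is taken to be all of [S], or the multiplication algebra
    inside ['End(S)]. *)
Definition right_stable L := forall x b, x \in L -> b \in M -> x * b \in L.

Definition semiprime_in L :=
  forall a, a \in L -> (forall b, b \in M -> a * b * a = 0) -> a = 0.

Lemma right_annihilated L y : right_stable L ->
  exists K, right_stable K /\ forall x, x \in K <-> x \in L /\ y * x = 0.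
Proof.
move=> idL; have [||K KP] := @vspace_of_pred k E (fun x => x \in L /\ y * x = 0).
- by rewrite mem0v mulr0.
- move=> c u v [uL yu] [vL yv]; split; first by rewrite rpredD // rpredZ.
  by rewrite mulrDr -scalerAr yu yv scaler0 addr0.
exists K; split=> // x b /KP [xL yx] bM; apply/KP.
by rewrite idL // mulrA yx mul0r.
Qed.

Lemma dim_right_annihilated L K x : (forall z, z \in K -> z \in L) ->
  x \in L -> x \notin K -> (\dim K < \dim L)%N.
Proof.
move=> KL xL xNK; have sKL : (K <= L)%VS by apply/subvP.
rewrite (ltn_leqif (dimv_leqif_sup sKL)).
by apply: contra xNK => /subvP; apply.
Qed.

(** Pick [y = a * b] in [L] with [y * a != 0]; its annihilator [K] in [L] is smaller than [L]. If
    [K] is nonzero, recurse into it. Otherwise left multiplication by [y] is bijective on [L], so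
    [y = y * e] with [e] in [L], and [e * e - e] lies in [K = 0]. *)
Lemma exists_idempotent L : (L <= M)%VS -> right_stable L -> semiprime_in L ->
  L != 0%VS -> exists e, [/\ e \in L, e != 0 & e * e = e].
Proof.
have [n] := ubnP (\dim L); elim: n L => // n IHn L ltLn LM idL spL L0.
have aL := memv_pick L; set a := vpick L in aL.
have a0 : a != 0 by rewrite vpick0.
have [b bM aba] : exists2 b, b \in M & a * b * a != 0.
  apply: contrapT => /forall2NP nb; case/eqP: a0; apply: spL => // b bM.
  by have [//|/negP/negPn/eqP] := nb b.
pose y := a * b; have yL : y \in L by apply: idL.
have ya : y * a != 0 by [].
have [K [idK KP]] := right_annihilated y idL.
have KL z : z \in K -> z \in L by case/KP.
have ltKL : (\dim K < \dim L)%N.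
  apply: (dim_right_annihilated KL aL).
  by apply/negP => /KP [_ ya0]; rewrite ya0 eqxx in ya.
have sKL : (K <= L)%VS by apply/subvP.
have [K0|K0] := eqVneq K 0%VS; last first.
  have [||e [eK e0 ee]] := IHn K _ (subv_trans sKL LM) idK _ K0.
  - exact: leq_trans ltKL _.
  - by move=> z /KL zL; apply: spL.
  by exists e; rewrite KL.
have imL : (amull y @: L = L)%VS.
  apply/eqP; rewrite eqEdim; apply/andP; split.
    apply/subvP => _ /memv_imgP [z zL ->]; rewrite lfunE /=.
    by apply: idL => //; apply: (subvP LM).
  rewrite limg_dim_eq //; apply/eqP; rewrite -subv0; apply/subvP => z.
  rewrite memv_cap memv_ker lfunE /= => /andP [zL /eqP yz].
  by rewrite -K0; apply/KP.
have : y \in (amull y @: L)%VS by rewrite imL.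
case/memv_imgP => e eL; rewrite lfunE /= => ye.
have y0 : y != 0 by apply: contra_neq ya => ->; rewrite mul0r.
exists e; split=> //; first by apply: contra_neq y0 => e0; rewrite ye e0 mulr0.
apply/eqP; rewrite -subr_eq0 -memv0 -K0; apply/KP; split.
  by rewrite rpredB // idL // (subvP LM).
by rewrite mulrBr mulrA -!ye subrr.
Qed.

Lemma idempotent_generator L : (L <= M)%VS -> right_stable L -> semiprime_in L ->
  exists2 e, e \in L & forall x, x \in L -> e * x = x.
Proof.
have [n] := ubnP (\dim L); elim: n L => // n IHn L ltLn LM idL spL.
have [L0|L0] := eqVneq L 0%VS.
  by exists 0 => [|x]; rewrite ?mem0v // L0 memv0 => /eqP ->; rewrite mulr0.
have [g [gL g0 gg]] := exists_idempotent LM idL spL L0.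
have [K [idK KP]] := right_annihilated g idL.
have KL z : z \in K -> z \in L by case/KP.
have ltKL : (\dim K < \dim L)%N.
  apply: (dim_right_annihilated KL gL).
  by apply/negP => /KP [_]; rewrite gg; apply/eqP.
have [|||f fK fP] := IHn K (leq_trans ltKL ltLn).
- by apply: subv_trans LM; apply/subvP.
- by [].
- by move=> z /KL zL; apply: spL.
have [fL gf] := (KP f).1 fK.
(* For [x] in [L], [f] fixes [x - g * x], which lies in [K]; hence [g * x + f * (x - g * x) = x]. *)
exists (g + f - f * g).
  by rewrite rpredB ?rpredD // idL // (subvP LM).
move=> x xL; have xgK : x - g * x \in K.
  apply/KP; split; last by rewrite mulrBr mulrA gg subrr.
  by rewrite rpredB // idL // (subvP LM).
by move/fP: xgK; rewrite mulrBr => fx; rewrite mulrBl mulrDl -mulrA -addrA fx addrC subrK.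
Qed.

End IdempotentGenerator.

(** * Sandwich operators and central idempotents *)

Section Sandwich.

Variables (k : fieldType) (S : falgType k).
Implicit Types (l m : seq (S * S)) (a s x : S).

(* A list of pairs stands for an element of S (x) S^op; [sandwich] is its action
   on S. *)
Definition sandwich l x := \sum_(p <- l) p.1 * x * p.2.

Lemma sandwich_cat l m x : sandwich (l ++ m) x = sandwich l x + sandwich m x.
Proof. exact: big_cat. Qed.

Lemma sandwich_mull s l x :
  sandwich [seq (s * p.1, p.2) | p <- l] x = s * sandwich l x.
Proof.
by rewrite /sandwich big_map mulr_sumr; apply: eq_bigr => p _; rewrite /= !mulrA.
Qed.

Lemma sandwich_mulr s l x :
  sandwich [seq (p.1, p.2 * s) | p <- l] x = sandwich l x * s.
Proof.
by rewrite /sandwich big_map mulr_suml; apply: eq_bigr => p _; rewrite /= !mulrA.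
Qed.

Lemma sandwich_scale (c : k) l x :
  sandwich [seq (c *: p.1, p.2) | p <- l] x = c *: sandwich l x.
Proof.
rewrite /sandwich big_map scaler_sumr; apply: eq_bigr => p _ /=.
by rewrite -!scalerAl.
Qed.

Lemma sandwich_comp l m x :
  sandwich [seq (p.1 * q.1, q.2 * p.2) | p <- l, q <- m] x =
  sandwich l (sandwich m x).
Proof.
rewrite /sandwich big_allpairs_dep; apply: eq_bigr => p _.
by rewrite mulr_sumr mulr_suml; apply: eq_bigr => q _; rewrite /= !mulrA.
Qed.

Definition semiprime := forall a, (forall s, a * s * a = 0) -> a = 0.

Definition central x := forall s, s * x = x * s.

Hypothesis spS : semiprime.

(** Let [e] be a left identity of the two-sided ideal [N] generated by [a]. Semiprimeness makes [e]
    a right identity of [N] too, so [s * e] and [e * s] both equal [e * s * e]. *)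
Lemma central_idempotent a :
  exists l, central (sandwich l a) /\ a * sandwich l a = a.
Proof.
have [||N NP] := @vspace_of_pred k S (fun x => exists l, x = sandwich l a).
- by exists [::]; rewrite /sandwich big_nil.
- move=> c _ _ [l ->] [m ->]; exists ([seq (c *: p.1, p.2) | p <- l] ++ m).
  by rewrite sandwich_cat sandwich_scale.
have Nl s x : x \in N -> s * x \in N.
  move=> /NP [l ->]; apply/NP.
  by exists [seq (s * p.1, p.2) | p <- l]; rewrite sandwich_mull.
have Nr s x : x \in N -> x * s \in N.
  move=> /NP [l ->]; apply/NP.
  by exists [seq (p.1, p.2 * s) | p <- l]; rewrite sandwich_mulr.
have [||| e eN eP] := @idempotent_generator k S fullv N.
- exact: subvf.
- by move=> x b xN _; apply: Nr.
- by move=> x _ xP; apply: spS => s; apply: xP; apply: memvf.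
have eP' x : x \in N -> x * e = x.
  move=> xN; apply/eqP; rewrite -subr_eq0; apply/eqP; apply: spS => s.
  by rewrite -mulrA mulrBl -mulrA eP ?subrr // Nl // rpredB // Nr.
have aN : a \in N by apply/NP; exists [:: (1, 1)]; rewrite /sandwich big_seq1 mul1r mulr1.
have [l el] := (NP e).1 eN; exists l; rewrite -el; split; last exact: eP'.
by move=> s; rewrite -[RHS](eP' _ (Nr _ _ eN)) -mulrA eP // Nl.
Qed.

End Sandwich.

(** * Bilinear maps in place of tensor products *)

Section Bilinear.

Variables (k : fieldType) (S : falgType k) (V : lmodType k).

(** Lists of pairs represent tensors, and an equality of tensors is expressed by evaluating all
    bilinear maps on both sides. *)
Definition bilin (be : S -> S -> V) :=
  (forall a, linear (be a)) /\ (forall b, linear (be^~ b)).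

Variables (be : S -> S -> V) (bil : bilin be).

Lemma bilinDl a a' b : be (a + a') b = be a b + be a' b.
Proof. by have := bil.2 b 1 a a'; rewrite /= !scale1r. Qed.

Lemma bilinDr a b b' : be a (b + b') = be a b + be a b'.
Proof. by have := bil.1 a 1 b b'; rewrite /= !scale1r. Qed.

Lemma bilin0l b : be 0 b = 0.
Proof. by apply: (addIr (be 0 b)); rewrite -bilinDl !add0r. Qed.

Lemma bilin0r a : be a 0 = 0.
Proof. by apply: (addIr (be a 0)); rewrite -bilinDr !add0r. Qed.

Lemma bilinZl c a b : be (c *: a) b = c *: be a b.
Proof. by have := bil.2 b c a 0; rewrite /= addr0 bilin0l addr0. Qed.

Lemma bilinZr c a b : be a (c *: b) = c *: be a b.
Proof. by have := bil.1 a c b 0; rewrite /= addr0 bilin0r addr0. Qed.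

Lemma bilin_suml I (r : seq I) (F : I -> S) b :
  be (\sum_(i <- r) F i) b = \sum_(i <- r) be (F i) b.
Proof. by apply: (big_morph (be^~ b)) => [x y|]; rewrite ?bilinDl ?bilin0l. Qed.

Lemma bilin_sumr I (r : seq I) (F : I -> S) a :
  be a (\sum_(i <- r) F i) = \sum_(i <- r) be a (F i).
Proof. by apply: (big_morph (be a)) => [x y|]; rewrite ?bilinDr ?bilin0r. Qed.

Lemma bilinNl a b : be (- a) b = - be a b.
Proof. by rewrite -(scaleN1r a) bilinZl scaleN1r. Qed.

Lemma bilin_mul s t s' t' : bilin (fun a b => be (s * a * t) (s' * b * t')).
Proof.
split=> [a c b b'|b c a a'] /=.
  by rewrite mulrDr mulrDl -scalerAr -scalerAl bilinDr bilinZr.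
by rewrite mulrDr mulrDl -scalerAr -scalerAl bilinDl bilinZl.
Qed.

End Bilinear.

(** * The separability idempotent of the center *)

Lemma exists_irreducible_divisor (k : fieldType) (d : {poly k}) :
  d != 0 -> size d != 1 -> exists2 q, irreducible_poly q & q %| d.
Proof.
have [n] := ubnP (size d); elim: n d => // n IHn d ltdn d0 d1.
have [irr|nirr] := pselect (irreducible_poly d).
  by exists d; rewrite ?dvdpp.
have [q [q1 qd nqd]] : exists q : {poly k}, [/\ size q != 1, q %| d & ~~ (q %= d)].
  apply: contrapT => nq; apply: nirr; split.
    by move: d0 d1; rewrite -size_poly_eq0; case: (size d) => [|[]].
  by move=> q q1 qd; apply: contrapT => /negP nqd; apply: nq; exists q.
have q0 : q != 0 by apply: contraTneq qd => ->; rewrite dvd0p.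
have ltqd : (size q < size d)%N.
  by rewrite ltn_neqAle dvdp_leq // andbT dvdp_size_eqp.
have [r irr rq] := IHn q (leq_trans ltqd ltdn) q0 q1.
by exists r => //; apply: dvdp_trans qd.
Qed.

Section Casimir.

Variables (k : fieldType) (S : falgType k).
Implicit Types (l : seq (S * S)) (x z : S).

(** As an identity of tensors: sum p.1 z (x) p.2 = sum p.1 (x) z p.2. *)
Definition balanced l z := forall (V : lmodType k) (be : S -> S -> V), bilin be ->
  \sum_(p <- l) be (p.1 * z) p.2 = \sum_(p <- l) be p.1 (z * p.2).

Definition central_pairs l := forall p, p \in l -> central p.1 /\ central p.2.

Lemma horner_alg_monomial x (c : k) i : horner_alg x (c *: 'X^i) = c *: x ^+ i.
Proof. by rewrite linearZ /= rmorphXn /= horner_algX mulr_algl. Qed.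

Lemma horner_algE x (p : {poly k}) :
  horner_alg x p = \sum_(i < size p) p`_i *: x ^+ i.
Proof.
rewrite -{1}[p]coefK poly_def raddf_sum /=; apply: eq_bigr => i _.
exact: horner_alg_monomial.
Qed.

Lemma centralZ (c : k) x : central x -> central (c *: x).
Proof. by move=> cx s; rewrite -scalerAr -scalerAl cx. Qed.

Lemma centralD x z : central x -> central z -> central (x + z).
Proof. by move=> cx cz s; rewrite mulrDl mulrDr cx cz. Qed.

Lemma centralM x z : central x -> central z -> central (x * z).
Proof. by move=> cx cz s; rewrite mulrA cx -mulrA cz mulrA. Qed.

Lemma centralX x n : central x -> central (x ^+ n).
Proof. by move=> cx s; exact: (commrX n (cx s)). Qed.

Lemma central_horner_alg x p : central x -> central (horner_alg x p).
Proof.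
move=> cx s; rewrite horner_algE mulr_sumr mulr_suml; apply: eq_bigr => i _.
exact: (centralZ _ (centralX _ cx)).
Qed.

Lemma exists_annihilator x : exists2 p : {poly k}, p != 0 & horner_alg x p = 0.
Proof.
apply: contrapT => nann.
pose n := (\dim {:S}).+1; pose X := [tuple x ^+ i | i < n].
have fX : free X.
  apply/freeP => c c0 i; pose p := \poly_(j < n) c (inord j).
  have p0 : p = 0.
    apply: contrapT => /eqP p0; case: nann; exists p => //.
    rewrite -[RHS]c0 /p poly_def raddf_sum /=; apply: eq_bigr => j _.
    by rewrite horner_alg_monomial inord_val nth_mktuple.
  by have := coef_poly n (fun j => c (inord j)) i; rewrite -/p p0 coef0 ltn_ord inord_val.
have := dimvS (subvf <<X>>%VS).
by move: fX; rewrite /free => /eqP ->; rewrite size_tuple ltnn.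
Qed.

Hypothesis spS : semiprime S.

(** Take an annihilator [f] of least degree. An irreducible [q] dividing both [f] and its derivative
    divides [f] twice, because [q] is separable; then [h = f / q] already kills [x], against
    minimality. *)
Lemma central_separable_annihilator x : perfect k -> central x ->
  exists2 p : {poly k}, separable_poly p & horner_alg x p = 0.
Proof.
move=> perfk cx.
pose P n := `[< exists p : {poly k}, [/\ p != 0, horner_alg x p = 0 & size p = n] >].
have exP : exists n, P n.
  have [p p0 px] := exists_annihilator x.
  by exists (size p); apply/asboolP; exists p.
case: (ex_minnP exP) => n /asboolP [f [f0 fx sf]] minf; exists f => //.
rewrite unlock; apply/negPn/negP; rewrite /coprimep => gcd1.
have [|q irrq] := exists_irreducible_divisor _ gcd1.
  by rewrite gcdp_eq0 (negPf f0).
rewrite dvdp_gcd => /andP [/dvdpP [h fE] qf'].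
have sepq : coprimep q q^`() by move: (perfk q irrq); rewrite unlock.
have qh : q %| h.
  by move: qf'; rewrite fE derivM (dvdp_addr _ (dvdp_mulIr _ _)) Gauss_dvdpl.
have [g hE] := dvdpP _ _ qh.
have h0 : h != 0 by apply: contra_neq f0 => h0; rewrite fE h0 mul0r.
(* As [h = g * q], the square of [h(x)] is [g(x) * f(x) = 0], and a central element of square zero
   vanishes in a semiprime algebra. *)
have hx : horner_alg x h = 0.
  apply: spS => s; rewrite (central_horner_alg _ cx) mulrA -rmorphM /=.
  by rewrite {1}hE -mulrA (mulrC q) -fE rmorphM /= fx mulr0 mul0r.
have : (n <= size h)%N by apply: minf; apply/asboolP; exists h.
rewrite -sf fE size_mul ?(irredp_neq0 irrq) // => les.
have q1 : (1 < size q)%N := irrq.1.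
move: h0 les q1; rewrite -size_poly_gt0.
by case: (size h) (size q) => [|a] [|[|b]] //= _; rewrite !addnS ltnS ltnNge leq_addr.
Qed.

(* With f the polynomial, the tensor is
   (f(X) - f(Y)) / (X - Y) * (1 (x) f'(x)^-1). *)
Lemma casimir_elt x : perfect k -> central x ->
  exists l, [/\ central_pairs l, \sum_(p <- l) p.1 * p.2 = 1 & balanced l x].
Proof.
move=> perfk cx; have [f sepf fx] := central_separable_annihilator perfk cx.
have [[u v] /= uv] : exists u, u.1 * f + u.2 * f^`() = 1.
  by apply/Bezout_eq1_coprimepP; move: sepf; rewrite unlock.
(* The Bezout relation makes [w] the inverse of [f'(x)]. *)
pose w := horner_alg x v; have cw : central w by apply: central_horner_alg.
have f'w : horner_alg x f^`() * w = 1.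
  have := congr1 (horner_alg x) uv.
  by rewrite rmorphD !rmorphM /= fx mulr0 add0r rmorph1 /w cw.
exists [seq (f`_m *: x ^+ i, x ^+ (m - i.+1) * w)
         | m <- index_iota 0 (size f), i <- index_iota 0 m]; split.
- move=> p /allpairsPdep [m [i [_ _ ->]]] /=; split.
    exact: (centralZ _ (centralX _ cx)).
  exact: (centralM (centralX _ cx)).
- rewrite big_allpairs_dep -[RHS]f'w -{4}[f]coefK poly_def big_mkord.
  rewrite !raddf_sum mulr_suml; apply: eq_bigr => m _ /=.
  rewrite derivZ derivXn -scalerMnr raddfMn /= horner_alg_monomial.
  rewrite mulrnAl -scalerAl.
  rewrite big_nat (eq_bigr (fun=> f`_m *: (x ^+ m.-1 * w))) => [|i /= im].
    rewrite -big_nat big_const_nat subn0 iter_addr_0.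
    by [].
  rewrite -scalerAl mulrA -exprD.
  by case: (m : nat) im => // m' im; rewrite subSS subnKC.
move=> V be bil; rewrite !big_allpairs_dep; apply/eqP; rewrite -subr_eq0 -sumrB.
(* Multiplying either factor by [x] yields consecutive values of [G m], so the difference telescopes
   for each [m]. The ends add up over [m] to [be (f(x)) w - be 1 (f(x) * w)], which is 0. *)
pose G m i := be (x ^+ i) (x ^+ (m - i) * w).
have -> : \sum_(m <- index_iota 0 (size f))
   (\sum_(i <- index_iota 0 m) be (f`_m *: x ^+ i * x) (x ^+ (m - i.+1) * w) -
    \sum_(i <- index_iota 0 m) be (f`_m *: x ^+ i) (x * (x ^+ (m - i.+1) * w)))
  = \sum_(m <- index_iota 0 (size f)) f`_m *: (be (x ^+ m) w - be 1 (x ^+ m * w)).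
  apply: eq_bigr => m _; rewrite -sumrB.
  have -> : be (x ^+ m) w - be 1 (x ^+ m * w) = G m m - G m 0%N.
    by rewrite /G subnn subn0 mul1r.
  rewrite -telescope_sumr // scaler_sumr !big_nat; apply: eq_bigr => i /= im.
  rewrite -scalerAl !(bilinZl bil) -scalerBr /G -exprSr mulrA -exprS.
  by rewrite -subSn // subSS.
rewrite big_mkord.
under eq_bigr do rewrite scalerBr -(bilinZl bil) -(bilinZr bil) scalerAl.
rewrite sumrB -(bilin_suml bil) -(bilin_sumr bil) -mulr_suml -!horner_algE fx.
by rewrite mul0r (bilin0l bil) (bilin0r bil) subr0.
Qed.

(** A product of two such tensors with central entries is balanced for every central element for
    which one of the factors is. *)
Lemma casimir_seq (X : seq S) : perfect k -> (forall x, x \in X -> central x) ->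
  exists l, [/\ central_pairs l, \sum_(p <- l) p.1 * p.2 = 1 &
                forall x, x \in X -> balanced l x].
Proof.
move=> perfk; elim: X => [_|x X IHX cX].
  exists [:: (1, 1)]; split=> //; last by rewrite big_seq1 mulr1.
  by move=> p; rewrite inE => /eqP -> /=; split=> s; rewrite commr1.
have [|l [cl l1 ball]] := IHX; first by move=> y yX; apply: cX; rewrite inE yX orbT.
have [|m [cm m1 balm]] := casimir_elt perfk (x := x); first by apply/cX/mem_head.
exists [seq (p.1 * q.1, q.2 * p.2) | p <- l, q <- m]; split.
- move=> _ /allpairsP [[p q] [/= /cl [cp1 cp2] /cm [cq1 cq2] ->]] /=.
  by split; apply: centralM.
- rewrite big_allpairs_dep -[RHS]l1; apply: eq_bigr => p _ /=.
  rewrite -[in RHS](mulr1 p.1) -m1 mulr_sumr mulr_suml.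
  by apply: eq_bigr => q _; rewrite !mulrA.
move=> y yX V be bil; rewrite !big_allpairs_dep /=.
have cy : central y by apply: cX.
move: yX; rewrite inE => /predU1P [yx|yX].
  apply: eq_bigr => p _.
  have /= := balm V _ (bilin_mul bil p.1 1 1 p.2).
  rewrite yx; under eq_bigr do rewrite mulr1 mul1r.
  under [in RHS]eq_bigr do rewrite mulr1 mul1r.
  move=> bx; under eq_bigr do rewrite -mulrA.
  by under [in RHS]eq_bigr do rewrite mulrA.
rewrite exchange_big [RHS]exchange_big /= big_seq [RHS]big_seq.
apply: eq_bigr => q /cm [cq1 cq2].
have /= := ball y yX V _ (bilin_mul bil 1 q.1 q.2 1).
under eq_bigr do rewrite mulr1 mul1r.
under [in RHS]eq_bigr do rewrite mulr1 mul1r.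
move=> bx; under eq_bigr do rewrite -mulrA cy mulrA.
by under [in RHS]eq_bigr do rewrite mulrA -cy -mulrA.
Qed.

(** Balance is linear in [z], so it is enough to have it on a basis of the center. *)
Lemma central_casimir : perfect k ->
  exists l, [/\ central_pairs l, \sum_(p <- l) p.1 * p.2 = 1 &
                forall z, central z -> balanced l z].
Proof.
move=> perfk; have [||Z ZP] := @vspace_of_pred k S (@central k S).
- by move=> s; rewrite mul0r mulr0.
- by move=> c x y cx cy; apply: centralD => //; apply: centralZ.
have [|l [cl l1 ball]] := @casimir_seq (vbasis Z) perfk.
  by move=> x /vbasis_mem /ZP.
exists l; split=> // z /ZP /coord_vbasis -> V be bil.
under eq_bigr do rewrite mulr_sumr (bilin_suml bil).
under [in RHS]eq_bigr do rewrite mulr_suml (bilin_sumr bil).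
rewrite exchange_big [RHS]exchange_big /=; apply: eq_bigr => i _.
under eq_bigr do rewrite -scalerAr (bilinZl bil).
under [in RHS]eq_bigr do rewrite -scalerAl (bilinZr bil).
by rewrite -!scaler_sumr ball ?mem_nth ?size_tuple.
Qed.

End Casimir.

(** * The separability idempotent of a semiprime algebra *)

Section Separability.

Variables (k : fieldType) (S : falgType k).
Implicit Types (l m : seq (S * S)) (s x : S).

Hypothesis spS : semiprime S.

Local Notation n := (\dim {:S}).
Local Notation b := (vbasis {:S}).
Implicit Type t : {ffun 'I_n -> S}.

(* [t] stands for the tensor \sum_(i < n) t i (x) b_i. *)
Definition annihilates t := forall x, \sum_(i < n) t i * x * b`_i = 0.

Section TwistedByCasimir.

Variable l : seq (S * S).
Hypothesis cl : central_pairs l.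
Hypothesis l1 : \sum_(p <- l) p.1 * p.2 = 1.
Hypothesis ball : forall z, central z -> balanced l z.

(** The tensor sum t_i p.1 (x) p.2 b_i, that is [t] multiplied by the Casimir element [l], with its
    second factors expanded in the basis again. *)
Definition twist t : {ffun 'I_n -> S} :=
  [ffun j => \sum_(p <- l) \sum_(i < n) coord b j (p.2 * b`_i) *: (t i * p.1)].

Lemma sum_twist (V : lmodType k) (be : S -> S -> V) t : bilin be ->
  \sum_j be (twist t j) b`_j =
  \sum_(p <- l) \sum_(i < n) be (t i * p.1) (p.2 * b`_i).
Proof.
move=> bil; under eq_bigr do rewrite ffunE (bilin_suml bil).
rewrite exchange_big /=; apply: eq_bigr => p _.
under eq_bigr do rewrite (bilin_suml bil).
rewrite exchange_big /=; apply: eq_bigr => i _.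
rewrite [in RHS](coord_vbasis (memvf (p.2 * _))) (bilin_sumr bil).
by apply: eq_bigr => j _; rewrite (bilinZl bil) (bilinZr bil).
Qed.

Lemma bilin_coord t (j : 'I_n) :
  bilin (fun u v => \sum_(i < n) coord b j (v * b`_i) *: (t i * u)).
Proof.
split=> [u c v v'|v c u u'] /=; rewrite scaler_sumr -big_split /=;
  apply: eq_bigr => i _.
  by rewrite mulrDl -scalerAl linearD linearZ /= scalerDl scalerA.
by rewrite mulrDr -scalerAr scalerDr !scalerA mulrC.
Qed.

(** The Casimir element is idempotent: balance moves [p.1] across to meet [p.2], and the products
    [p.1 * p.2] add up to 1. *)
Lemma twist_idem t : twist (twist t) = twist t.
Proof.
apply/ffunP => j; rewrite !ffunE.
transitivity (\sum_(q <- l) \sum_(p <- l)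
    \sum_(i < n) coord b j (q.2 * p.2 * b`_i) *: (t i * (q.1 * p.1))).
  apply: eq_bigr => q _.
  rewrite (sum_twist (be := fun u v => coord b j (q.2 * v) *: (u * q.1))).
    apply: eq_big_seq => p /cl [cp1 cp2].
    by apply: eq_bigr => i _; rewrite mulrA -[t i * _ * _]mulrA cp1.
  split=> [u c v v'|v c u u'] /=.
    by rewrite mulrDr -scalerAr linearD linearZ /= scalerDl scalerA.
  by rewrite mulrDl -scalerAl scalerDr !scalerA mulrC.
rewrite exchange_big /=.
transitivity (\sum_(p <- l) \sum_(q <- l)
    \sum_(i < n) coord b j (q.2 * (p.1 * p.2) * b`_i) *: (t i * q.1)).
  apply: eq_big_seq => p /cl [cp1 cp2].
  have /= bp := ball cp1 (bilin_mul (bilin_coord t j) 1 1 1 p.2).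
  transitivity (\sum_(q <- l) \sum_(i < n)
      coord b j ((1 * q.2 * p.2) * b`_i) *: (t i * (1 * (q.1 * p.1) * 1))).
    by apply: eq_bigr => q _; apply: eq_bigr => i _; rewrite !mul1r mulr1.
  rewrite bp; apply: eq_bigr => q _; apply: eq_bigr => i _.
  by rewrite !mul1r mulr1 !mulrA cp1.
rewrite exchange_big /=; apply: eq_bigr => q _.
rewrite exchange_big /=; apply: eq_bigr => i _.
by rewrite -scaler_suml -linear_sum /= -mulr_suml -mulr_sumr l1 mulr1.
Qed.

(** The entries of [l] are central with products adding up to 1, so the twist does not change the
    action on [S]. *)
Lemma annihilates_twist t : annihilates t -> annihilates (twist t).
Proof.
move=> t0 x; rewrite (sum_twist (be := fun u v => u * x * v)); last first.
  split=> [u c v v'|v c u u'] /=; first by rewrite mulrDr -scalerAr.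
  by rewrite !mulrDl -!scalerAl.
rewrite exchange_big /= -[RHS](t0 x); apply: eq_bigr => i _.
transitivity (\sum_(p <- l) t i * x * (p.1 * p.2) * b`_i).
  apply: eq_big_seq => p /cl [cp1 cp2].
  by rewrite -[t i * p.1 * x]mulrA -cp1 !mulrA.
by rewrite -mulr_suml -mulr_sumr l1 mulr1.
Qed.

(** Acts on the first tensor factors only; sums of such maps apply one sandwich operator to all
    coordinates of [t]. *)
Definition lrmul (r s : S) t : {ffun 'I_n -> S} := [ffun i => r * t i * s].

Lemma twist_lrmul r s t : twist (lrmul r s t) = lrmul r s (twist t).
Proof.
apply/ffunP => j; rewrite !ffunE mulr_sumr mulr_suml.
apply: eq_big_seq => p /cl [cp1 _]; rewrite mulr_sumr mulr_suml.
apply: eq_bigr => i _; rewrite !ffunE -scalerAr -scalerAl -!mulrA.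
by congr (_ *: (_ * (_ * _))); rewrite cp1.
Qed.

Lemma annihilates_lrmul r s t : annihilates t -> annihilates (lrmul r s t).
Proof.
move=> t0 x; transitivity (r * \sum_(i < n) t i * (s * x) * b`_i).
  by rewrite mulr_sumr; apply: eq_bigr => i _; rewrite ffunE !mulrA.
by rewrite t0 mulr0.
Qed.

Lemma twistD t t' : twist (t + t') = twist t + twist t'.
Proof.
apply/ffunP => j; rewrite !ffunE -big_split /=; apply: eq_bigr => p _.
rewrite -big_split /=; apply: eq_bigr => i _.
by rewrite ffunE mulrDl scalerDr.
Qed.

Lemma annihilatesD t t' : annihilates t -> annihilates t' -> annihilates (t + t').
Proof.
move=> t0 t'0 x; under eq_bigr do rewrite ffunE !mulrDl.
by rewrite big_split /= t0 t'0 addr0.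
Qed.

(** Balance moves each central [t i] to the second factor, where the sum of the [t i * b_i] appears;
    this is the action on 1, hence zero. *)
Lemma central_annihilating t : twist t = t -> annihilates t ->
  (forall i, central (t i)) -> t = 0.
Proof.
move=> tt t0 ct; rewrite -tt; apply/ffunP => j; rewrite !ffunE.
rewrite exchange_big /=.
transitivity (\sum_(i < n) \sum_(p <- l) coord b j (p.2 * (t i * b`_i)) *: p.1).
  apply: eq_bigr => i _.
  have bil : bilin (fun u v => coord b j (v * b`_i) *: u).
    split=> [u c v v'|v c u u'] /=.
      by rewrite mulrDl -scalerAl linearD linearZ /= scalerDl scalerA.
    by rewrite scalerDr !scalerA mulrC.
  have /= bi := ball (ct i) bil.
  transitivity (\sum_(p <- l) coord b j (p.2 * b`_i) *: (p.1 * t i)).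
    by apply: eq_bigr => p _; rewrite ct.
  by rewrite bi; apply: eq_bigr => p _; rewrite mulrA -(ct i p.2) .
rewrite exchange_big big1 // => p _; rewrite -scaler_suml -linear_sum /=.
rewrite -mulr_sumr; have := t0 1; under eq_bigr do rewrite mulr1.
by move=> ->; rewrite mulr0 linear0 scale0r.
Qed.

(* The minimal support argument of the classical proof that A (x) A^op is simple
   for A central simple. *)
Lemma twisted_annihilating t : twist t = t -> annihilates t -> t = 0.
Proof.
have [N] := ubnP #|[set i | t i != 0]|; elim: N t => // N IHN t ltN tt t0.
have [//|/eqP tn0] := eqVneq t 0.
have [i0 ti0] : exists i, t i != 0.
  apply: contrapT => nt; apply: tn0; apply/ffunP => i; rewrite ffunE.
  by apply/eqP/negPn/negP => ti; apply: nt; exists i.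
(* The sandwich [m] makes the entry at [i0] a central [e] with [t i0 * e = t i0], and creates no new
   nonzero entries. *)
have [m [ce te]] := central_idempotent spS (t i0).
pose t' := \sum_(p <- m) lrmul p.1 p.2 t.
have t'E i : t' i = sandwich m (t i).
  rewrite /t' sum_ffunE; apply: eq_bigr => p _; by rewrite ffunE.
have [tt' t'0] : twist t' = t' /\ annihilates t'.
  rewrite /t'; elim: m {ce te t' t'E} => [|p m [IH1 IH2]].
    rewrite !big_nil; split.
      apply/ffunP => j; rewrite !ffunE big1 // => p _.
      by rewrite big1 // => i _; rewrite ffunE mul0r scaler0.
    by move=> x; rewrite big1 // => i _; rewrite ffunE !mul0r.
  rewrite !big_cons; split; first by rewrite twistD IH1 twist_lrmul tt.
  by apply: annihilatesD => //; apply: annihilates_lrmul.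
have ct' i : central (t' i).
  (* The commutator of [s] with [t'] also vanishes at [i0], so its support is strictly smaller than
     that of [t]. *)
  move=> s; pose u := lrmul s 1 t' + lrmul (-1) s t'.
  have uE j : u j = s * t' j - t' j * s.
    by rewrite !ffunE mulr1 mulN1r mulNr.
  have u0 : u = 0.
    apply: IHN.
    - rewrite -ltnS; apply: (leq_trans _ ltN); rewrite ltnS; apply: proper_card; apply/properP; split.
        apply/subsetP => j; rewrite !inE; apply: contraNneq => tj.
        rewrite uE t'E tj /sandwich big1 ?mulr0 ?mul0r ?subr0 // => p _.
        by rewrite mulr0 mul0r.
      exists i0; first by rewrite inE.
      by rewrite inE uE t'E ce subrr eqxx.
    - by rewrite /u twistD !twist_lrmul tt'.
    - by apply: annihilatesD; apply: annihilates_lrmul.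
  by apply/eqP; rewrite -subr_eq0 -uE u0 ffunE.
have /ffunP /(_ i0) := central_annihilating tt' t'0 ct'.
rewrite t'E ffunE => e0; case/eqP: ti0.
by rewrite -te e0 mulr0.
Qed.

(** Expanding the second entries of [m] in the basis gives an annihilating family [t]; its twist is
    again annihilating and fixed by [twist], hence zero. *)
Lemma twisted_sandwich m (V : lmodType k) (be : S -> S -> V) : bilin be ->
  (forall x, sandwich m x = 0) ->
  \sum_(p <- m) \sum_(q <- l) be (p.1 * q.1) (q.2 * p.2) = 0.
Proof.
move=> bil m0; pose t := [ffun i => \sum_(p <- m) coord b i p.2 *: p.1].
have tE (W : lmodType k) (ga : S -> S -> W) : bilin ga ->
    \sum_(i < n) ga (t i) b`_i = \sum_(p <- m) ga p.1 p.2.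
  move=> bilg; under eq_bigr do rewrite ffunE (bilin_suml bilg).
  rewrite exchange_big /=; apply: eq_bigr => p _.
  rewrite [in RHS](coord_vbasis (memvf p.2)) (bilin_sumr bilg).
  by apply: eq_bigr => i _; rewrite (bilinZl bilg) (bilinZr bilg).
have t0 : annihilates t.
  move=> x; rewrite (tE _ (fun u v => u * x * v)); first exact: m0.
  split=> [u c v v'|v c u u'] /=; first by rewrite mulrDr -scalerAr.
  by rewrite !mulrDl -!scalerAl.
have tw0 : twist t = 0.
  by apply: twisted_annihilating; [apply: twist_idem | apply: annihilates_twist].
rewrite -(tE _ (fun u v => \sum_(q <- l) be (u * q.1) (q.2 * v))).
  rewrite exchange_big /= -(sum_twist t bil) tw0 big1 // => j _.
  by rewrite ffunE (bilin0l bil).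
split=> [u c v v'|v c u u'] /=; rewrite scaler_sumr -big_split /=;
  apply: eq_bigr => q _.
  by rewrite mulrDr -scalerAr (bilinDr bil) (bilinZr bil).
by rewrite mulrDl -scalerAl (bilinDl bil) (bilinZl bil).
Qed.

End TwistedByCasimir.

Import FalgLfun.

Lemma central_projection :
  exists m, sandwich m 1 = 1 /\ forall x, central (sandwich m x).
Proof.
pose mulfun m : 'End(S) := \sum_(p <- m) (amulr p.2 \o amull p.1)%VF.
have mulfunE m x : mulfun m x = sandwich m x.
  rewrite sum_lfunE; apply: eq_bigr => p _.
  by rewrite comp_lfunE !lfunE /=.
have [||M MP] := @vspace_of_pred k 'End(S) (fun w => exists m, w = mulfun m).
- by exists [::]; rewrite /mulfun big_nil.
- move=> c _ _ [l ->] [m ->]; exists ([seq (c *: p.1, p.2) | p <- l] ++ m).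
  apply/lfunP => x; rewrite add_lfunE scale_lfunE !mulfunE.
  by rewrite sandwich_cat sandwich_scale.
have Mmul m : mulfun m \in M by apply/MP; exists m.
have [||K KP] := @vspace_of_pred k 'End(S) (fun w => w \in M /\ w 1 = 0).
- by rewrite mem0v zero_lfunE.
- move=> c u v [uM u1] [vM v1]; split; first by rewrite rpredD // rpredZ.
  by rewrite add_lfunE scale_lfunE u1 v1 scaler0 addr0.
have [|||f fK fP] := @idempotent_generator k 'End(S) M K.
- by apply/subvP => w /KP [].
(* The product of ['End(S)] composes in reverse, [(w * v) x = v (w x)], so left ideals for
   composition are right stable here. *)
- move=> w v /KP [/MP [l wl] w1] /MP [m vm]; apply/KP; split; last first.
    by rewrite lfun_mulE w1 linear0.
  apply/MP; exists [seq (p.1 * q.1, q.2 * p.2) | p <- m, q <- l].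
  by apply/lfunP => x; rewrite lfun_mulE wl vm !mulfunE sandwich_comp.
(* With [e] central in the ideal of [w x] and [w x * e = w x], the map sending [y] to
   [x * sandwich m y] takes [w x] to [x * e]. Hence [0 = w (x * e) = w x * e = w x]. *)
- move=> w /KP [/MP [l wl] _] wMw; apply/lfunP => x; rewrite zero_lfunE.
  have [m [ce wxe]] := central_idempotent spS (w x).
  have := wMw _ (Mmul [seq (x * p.1, p.2) | p <- m]) => /lfunP /(_ x).
  rewrite zero_lfunE !lfun_mulE mulfunE sandwich_mull => wxe0.
  set e := sandwich m (w x) in ce wxe wxe0.
  rewrite -wxe -[RHS]wxe0 wl !mulfunE /sandwich mulr_suml; apply: eq_bigr => p _.
  by rewrite -!mulrA -ce.
have [/MP [m fm] f1] := (KP f).1 fK.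
pose e := (1, 1) :: [seq (- p.1, p.2) | p <- m].
have eE x : sandwich e x = x - f x.
  rewrite /sandwich /e big_cons /= mul1r mulr1 big_map fm mulfunE.
  by rewrite -sumrN; congr (_ + _); apply: eq_bigr => p _; rewrite /= !mulNr.
exists e; split=> [|x s]; first by rewrite eE f1 subr0.
(* The commutator with [s] kills 1, so it lies in [K] and [d (f x) = d x]: the element [x - f x]
   commutes with [s]. *)
pose d := mulfun [:: (s, 1); (- 1, s)].
have dE y : d y = s * y - y * s.
  by rewrite mulfunE /sandwich big_cons big_seq1 /= mulr1 mulN1r mulNr.
have dK : d \in K by apply/KP; split; rewrite ?Mmul // dE mulr1 mul1r subrr.
have /lfunP /(_ x) := fP d dK; rewrite lfun_mulE => dfx.
apply/eqP; rewrite -subr_eq0 -dE eE linearB /= dfx subrr eqxx //.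
Qed.

Lemma separability_idempotent : perfect k ->
  exists e : seq (S * S), \sum_(p <- e) p.1 * p.2 = 1 /\
    forall s (V : lmodType k) (be : S -> S -> V), bilin be ->
      \sum_(p <- e) be (s * p.1) p.2 = \sum_(p <- e) be p.1 (p.2 * s).
Proof.
move=> perfk; have [l [cl l1 ball]] := central_casimir spS perfk.
have [m [m1 cm]] := central_projection.
exists [seq (p.1 * q.1, q.2 * p.2) | p <- m, q <- l]; split.
  rewrite big_allpairs_dep /= -[RHS]m1 /sandwich; apply: eq_bigr => p _.
  transitivity (\sum_(q <- l) p.1 * (q.1 * q.2) * p.2).
    by apply: eq_bigr => q _; rewrite !mulrA.
  by rewrite -mulr_suml -mulr_sumr l1.
move=> s V be bil; rewrite !big_allpairs_dep /=; apply/eqP; rewrite -subr_eq0.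
(* The operator of [d] is the commutator of [s] with the values of [sandwich m], which are
   central. *)
pose d := [seq (s * p.1, p.2) | p <- m] ++ [seq (- p.1, p.2 * s) | p <- m].
have d0 x : sandwich d x = 0.
  rewrite sandwich_cat sandwich_mull cm -sandwich_mulr /sandwich !big_map.
  rewrite -big_split big1 // => p _ /=.
  by rewrite !mulNr subrr.
have /= := twisted_sandwich cl l1 ball bil d0.
rewrite /d big_cat !big_map /= => bd; apply/eqP; rewrite -[RHS]bd -sumrN.
congr (_ + _); apply: eq_bigr => p _; first by apply: eq_bigr => q _; rewrite mulrA.
rewrite -sumrN; apply: eq_bigr => q _.
by rewrite mulNr (bilinNl bil) mulrA.
Qed.

End Separability.

(** * The radical and its quotient *)

Section RadicalQuotientFinDim.

Variables (k : fieldType) (A : falgType k).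

(** Removing the component in the radical makes the value independent of the chosen representative,
    and hence linear. *)
Definition jlift (u : jquot A) : A := repr u - projv (jrad A) (repr u).

Lemma jlift_proj x : jlift (jproj x) = x - projv (jrad A) x.
Proof.
rewrite /jlift; set y := repr _.
have yx : projv (jrad A) y = y - x + projv (jrad A) x.
  by rewrite -(projv_id (jproj_repr_sub x)) linearB subrK.
by rewrite yx opprD opprB addrA (addrC y) subrK.
Qed.

Lemma jliftK : cancel jlift (@jproj k A).
Proof.
move=> u; rewrite -[RHS]jproj_repr; apply/jproj_eq.
by rewrite /jlift addrAC subrr add0r memvN memv_proj.
Qed.

Lemma jlift_is_linear : linear jlift.
Proof.
move=> c u v; rewrite -[u]jliftK -[v]jliftK -linearP !jlift_proj.
by move: (jlift u) (jlift v) => a b; rewrite linearP opprD addrACA scalerBr.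
Qed.

HB.instance Definition _ :=
  GRing.isLinear.Build k (jquot A) A *:%R jlift jlift_is_linear.

Local Notation C := ((jrad A)^C)%VS.

Fact jquot_vect_iso : Vector.axiom (\dim (jrad A)^C) (jquot A).
Proof.
exists (fun u => \row_i coord (vbasis C) i (jlift u)).
  by move=> c u v; apply/rowP=> i; rewrite !mxE jlift_is_linear linearP.
exists (fun rw : 'rV_(\dim C) => jproj (\sum_i rw 0 i *: (vbasis C)`_i)).
  move=> u; rewrite -[RHS]jliftK; congr jproj.
  rewrite [RHS](coord_vbasis (memv_projC _ _ : jlift u \in C)).
  by apply: eq_bigr => i _; rewrite mxE.
move=> rw; apply/rowP=> i; rewrite mxE jlift_proj.
set y := \sum_(j < _) _; have yC : y \in C.
  by apply: rpred_sum => j _; rewrite rpredZ ?vbasis_mem ?memt_nth.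
have -> : projv (jrad A) y = 0.
  by apply/eqP; rewrite -memv_ker lker_proj.
by rewrite subr0 coord_sum_free ?(basis_free (vbasisP C)).
Qed.

HB.instance Definition _ := Lmodule_hasFinDim.Build k (jquot A) jquot_vect_iso.
HB.instance Definition _ := Algebra_isFalgebra.Build k (jquot A).

Lemma jproj_eq0 (x : A) : jproj x = 0 <-> x \in jrad A.
Proof. by have := jproj_eq x 0; rewrite raddf0 subr0. Qed.

(** If [a] lay outside a maximal left ideal [M], then [1 - c * a] would be in [M] for some [c].
    Since [a * c * a] is in the radical, 1 = (1 + ca)(1 - ca) + c(aca) would be in [M]. *)
Lemma jquot_semiprime : semiprime (jquot A).
Proof.
move=> u; rewrite -[u]jproj_repr; set a := repr u => au.
have aJ s : a * s * a \in jrad A.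
  by apply/jproj_eq0; rewrite !rmorphM /= au.
apply/jproj_eq0/jradP => M maxM.
have [/left_idealP idM Mfull topM] := maxM.
apply: contrapT => /negP aNM.
have [||N NP] := @vspace_of_pred k A (fun x => exists c, x - c * a \in M).
- by exists 0; rewrite mul0r subr0 mem0v.
- move=> c x y [d xd] [d' yd]; exists (c *: d + d').
  rewrite mulrDl opprD addrACA -scalerAl -scalerBr.
  by rewrite rpredD // rpredZ.
have idN : left_ideal N.
  apply/left_idealP => b x /NP [c xc]; apply/NP; exists (b * c).
  by rewrite -mulrA -mulrBr idM.
have MN : (M <= N)%VS.
  by apply/subvP => x xM; apply/NP; exists 0; rewrite mul0r subr0.
case: (topM N idN MN) => [NM|Nfull].
  by case/negP: aNM; rewrite -NM; apply/NP; exists 1; rewrite mul1r subrr mem0v.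
have /NP [c cM] : 1 \in N by rewrite Nfull memvf.
have oneM : 1 \in M.
  have -> : 1 = (1 + c * a) * (1 - c * a) + c * (a * c * a).
    by rewrite mulrDl mul1r mulrBr mulr1 !mulrA addrA !subrK.
  apply: rpredD; apply: idM => //.
  exact: (jradP _).1 (aJ c) M maxM.
case/negP: Mfull; rewrite eqEsubv subvf; apply/subvP => y _.
by rewrite -[y]mulr1 idM.
Qed.

(** A form of Nakayama's lemma. For [W] maximal among the left ideals properly inside [V] and [v] in
    [V] outside [W], the elements [a] with [a * v] in [W] form a maximal left ideal, which contains
    the radical. *)
Lemma jrad_mul_maximal (V : {vspace A}) : left_ideal V -> V != 0%VS ->
  exists W, (\dim W < \dim V)%N /\ (jrad A * V <= W)%VS.
Proof.
move=> /left_idealP idV V0.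
pose Q n := `[< exists W : {vspace A},
  [/\ left_ideal W, (W <= V)%VS, W != V & \dim W = n] >].
have exQ : exists n, Q n.
  exists 0%N; apply/asboolP; exists 0%VS; rewrite dimv0 sub0v eq_sym; split=> //.
  by rewrite /left_ideal prodv0 subvv.
have boundQ n : Q n -> (n <= \dim V)%N.
  by move/asboolP=> [U [_ UV _ <-]]; rewrite dimvS.
case: (ex_maxnP exQ boundQ) => n /asboolP [W [idW WV WnV dW]] maxQ.
have ltWV : (\dim W < \dim V)%N by rewrite (ltn_leqif (dimv_leqif_eq WV)).
exists W; split=> //; apply/prodvP => x v xJ vV.
move/left_idealP: (idW) => idWP.
apply: contrapT => /negP xvNW.
pose M := (amulr v @^-1: W)%VS.
have ME a : (a \in M) = (a * v \in W) by rewrite -memv_preim lfunE.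
have vNW : v \notin W by apply: contra xvNW; apply: idWP.
case/negP: xvNW; rewrite -ME; apply: (jradP _).1 xJ _ _; split.
- by apply/left_idealP => a y; rewrite !ME -mulrA; apply: idWP.
- by apply: contraNneq vNW => Mfull; rewrite -[v]mul1r -ME Mfull memvf.
move=> N /left_idealP idN MN.
have [NM|/subvPn [a aN]] := boolP (N <= M)%VS.
  by left; apply/eqP; rewrite eqEsubv NM.
rewrite ME => avNW; right.
have [||U UP] := @vspace_of_pred k A (fun y => exists b, y - b * (a * v) \in W).
- by exists 0; rewrite mul0r subr0 mem0v.
- move=> c y z [d yd] [d' zd]; exists (c *: d + d').
  rewrite mulrDl opprD addrACA -scalerAl -scalerBr.
  by rewrite rpredD // rpredZ.
have WU : (W <= U)%VS.
  by apply/subvP => y yW; apply/UP; exists 0; rewrite mul0r subr0.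
have avU : a * v \in U by apply/UP; exists 1; rewrite mul1r subrr mem0v.
have UV : (U <= V)%VS.
  apply/subvP => y /UP [b yb]; rewrite -[y](subrK (b * (a * v))) rpredD //.
    exact: (subvP WV).
  by apply/idV/idV.
have UVeq : U = V.
  apply/eqP; apply: contraT => UnV.
  have : (\dim U <= n)%N.
    apply: maxQ; apply/asboolP; exists U; split=> //.
    apply/left_idealP => b y /UP [c yc]; apply/UP; exists (b * c).
    by rewrite -mulrA -mulrBr idWP.
  rewrite -dW => leUW; case/negP: avNW.
  by have /eqP -> : W == U by rewrite -(geq_leqif (dimv_leqif_eq WU)).
have /UP [b vb] : v \in U by rewrite UVeq.
have oneN : 1 \in N.
  rewrite -[1](subrK (b * a)) rpredD ?idN //; apply: (subvP MN).
  by rewrite ME mulrBl mul1r -mulrA.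
by apply/eqP; rewrite eqEsubv subvf; apply/subvP => y _; rewrite -[y]mulr1 idN.
Qed.

Lemma jrad_expS_ideal n : two_sided_ideal (jrad A ^+ n.+1)%VS.
Proof.
have /andP [idl idr] := jrad_ideal A; apply/andP; split.
  by rewrite expvSl prodvA prodvSl.
by rewrite expvSr -prodvA prodvSr.
Qed.

Lemma jrad_expS_sub n : (jrad A ^+ n.+1 <= jrad A)%VS.
Proof.
have /andP [_ idr] := jrad_ideal A; rewrite expvSl.
by apply: subv_trans idr; rewrite prodvSr ?subvf.
Qed.

(** Each nonzero power of the radical strictly contains the next, so the dimensions fall to 0. *)
Lemma jrad_nilpotent : exists n, (jrad A ^+ n.+1 = 0)%VS.
Proof.
have dimJ n : (\dim (jrad A ^+ n.+1) <= \dim {:A} - n)%N.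
  elim: n => [|n IHn]; first by rewrite subn0 dimvS ?subvf.
  have [J0|J0] := eqVneq (jrad A ^+ n.+1)%VS 0%VS.
    by rewrite expvSl J0 prodv0 dimv0.
  have /andP [idl _] := jrad_expS_ideal n.
  have [W [ltW sW]] := jrad_mul_maximal idl J0.
  rewrite expvSl (leq_trans (dimvS sW)) // subnS -ltnS.
  by rewrite (leq_trans ltW) // (leq_trans IHn) // leqSpred.
exists (\dim {:A}); apply/eqP; rewrite -dimv_eq0 -leqn0.
by rewrite -(subnn (\dim {:A})).
Qed.

End RadicalQuotientFinDim.

(** * Lifting the quotient and splitting the radical sequence *)

Section Lifting.

Variables (k : fieldType) (A : falgType k).
Implicit Type sg : 'Hom(jquot A, A).

Variable e : seq (jquot A * jquot A).
Hypothesis e1 : \sum_(p <- e) p.1 * p.2 = 1.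
Hypothesis eC : forall s (V : lmodType k) (be : jquot A -> jquot A -> V), bilin be ->
  \sum_(p <- e) be (s * p.1) p.2 = \sum_(p <- e) be p.1 (p.2 * s).

Local Notation J := (jrad A).

Definition defect sg a b := sg a * sg b - sg (a * b).

(* Up to a product of two defects, this is the Hochschild 2-cocycle condition. *)
Lemma defect_cocycle sg a b c :
  sg a * defect sg b c + defect sg a (b * c) =
  defect sg (a * b) c + defect sg a b * sg c.
Proof.
rewrite /defect mulrBr mulrBl !mulrA.
by rewrite subrKA [RHS]addrC subrKA.
Qed.

Lemma defect_linearl sg c : linear (fun v => defect sg v c).
Proof.
move=> x v v'; rewrite /defect mulrDl -scalerAl !linearP /= mulrDl -scalerAl.
by rewrite addrACA -scalerDr.
Qed.

Lemma defect_linearr sg c : linear (defect sg c).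
Proof.
move=> x v v'; rewrite /defect mulrDr -scalerAr !linearP /= mulrDr -scalerAr.
by rewrite addrACA -scalerDr.
Qed.

Lemma bilin_defect sg c : bilin (fun u v => sg u * defect sg v c).
Proof.
split=> [u x v v'|v x u u'].
  by rewrite defect_linearl mulrDr -scalerAr.
by rewrite linearP mulrDl -scalerAl.
Qed.

(** Contraction of the defect with the separability idempotent: a 1-cochain whose Hochschild
    coboundary is the defect, up to terms of higher order. *)
Definition correction sg c := \sum_(p <- e) sg p.1 * defect sg p.2 c.

Lemma correction_is_linear sg : linear (correction sg).
Proof.
move=> x c c'; rewrite /correction scaler_sumr -big_split /=.
by apply: eq_bigr => p _; rewrite defect_linearr mulrDr -scalerAr.
Qed.

HB.instance Definition _ sg :=
  GRing.isLinear.Build k (jquot A) A *:%R (correction sg) (correction_is_linear sg).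

Definition corrected sg : 'Hom(jquot A, A) := sg - linfun (correction sg).

Lemma correctedE sg a : corrected sg a = sg a - correction sg a.
Proof. by rewrite add_lfunE opp_lfunE lfunE. Qed.

(** Exact form of the coboundary computation. For a section [sg], [1 - sg 1] and all defects lie in
    the radical, so each term on the right is of higher order than the defect. *)
Lemma defect_corrected sg a b :
  defect (corrected sg) a b =
    (1 - sg 1) * defect sg a b
  - (\sum_(p <- e) defect sg p.1 p.2) * defect sg a b
  - \sum_(p <- e) defect sg a p.1 * defect sg p.2 b
  + correction sg a * correction sg b.
Proof.
have mm : \sum_(p <- e) sg p.1 * sg p.2 = sg 1 + \sum_(p <- e) defect sg p.1 p.2.
  rewrite -e1 linear_sum -big_split /=; apply: eq_bigr => p _.
  by rewrite /defect addrC subrK.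
(* The cocycle identity at [p.2], [a], [b], multiplied by [sg p.1] and summed over [e]. *)
have hs : correction sg a * sg b + \sum_(p <- e) sg p.1 * defect sg (p.2 * a) b =
    (\sum_(p <- e) sg p.1 * sg p.2) * defect sg a b + correction sg (a * b).
  rewrite /correction !mulr_suml -!big_split /=; apply: eq_bigr => p _.
  by rewrite -!mulrA -!mulrDr [in RHS]defect_cocycle addrC.
(* Replacing [sg a * sg p.1] by [sg (a * p.1)] costs a defect; [eC] then moves [a] to the other
   factor. *)
have sh : sg a * correction sg b =
    \sum_(p <- e) sg p.1 * defect sg (p.2 * a) b
    + \sum_(p <- e) defect sg a p.1 * defect sg p.2 b.
  rewrite -(eC _ (bilin_defect sg b)) -big_split mulr_sumr /=.
  apply: eq_bigr => p _; rewrite -mulrDl {2}/defect addrC subrK.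
  by rewrite mulrA.
rewrite [LHS]/defect !correctedE [in LHS]mulrBl ![in LHS]mulrBr sh.
set R := \sum_(p <- e) _ * _ in hs *; set Q := \sum_(p <- e) _ * _.
rewrite ![in LHS](opprD, opprK, addrA).
rewrite [LHS](+%R.[ACl 1*6*3*5*(4*2)*7]) /= -/(defect sg a b).
rewrite -opprD hs mm opprD addrA subrK mulrDl opprD [in RHS]mulrBl mul1r.
by rewrite addrA [LHS](+%R.[ACl 1*4*5*2*3]).
Qed.


(** Start from [jlift] and correct repeatedly: a correction in J^(n+1) keeps the section and leaves
    a defect in J times J^(n+1). *)
Lemma section_modulo_power n : exists sg : 'Hom(jquot A, A),
  (forall u, jproj (sg u) = u) /\ forall a b, defect sg a b \in (J ^+ n.+1)%VS.
Proof.
elim: n => [|n [sg [sgK sgM]]].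
  exists (linfun (@jlift k A)); split=> [u|a b]; first by rewrite lfunE /= jliftK.
  by apply/jproj_eq0; rewrite rmorphB rmorphM /= !lfunE /= !jliftK subrr.
have sJ := subvP (jrad_expS_sub A n).
have JM x y : x \in J -> y \in (J ^+ n.+1)%VS -> x * y \in (J ^+ n.+2)%VS.
  by move=> xJ yJ; rewrite expvSl memv_mul.
have cJ a : correction sg a \in (J ^+ n.+1)%VS.
  by apply: rpred_sum => p _; apply: two_sided_idealMl (jrad_expS_ideal A n) _.
exists (corrected sg); split=> [u|a b].
  by rewrite correctedE rmorphB /= sgK ((jproj_eq0 _).2 (sJ _ (cJ u))) subr0.
rewrite defect_corrected rpredD ?rpredB //.
- by apply: JM => //; apply/jproj_eq0; rewrite rmorphB rmorph1 /= sgK subrr.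
- by apply: JM => //; apply: rpred_sum => p _; apply: sJ.
- by apply: rpred_sum => p _; apply: JM => //; apply: sJ.
- by apply: JM => //; apply: sJ.
Qed.

Lemma split_of_separable : split_algebra A.
Proof.
have [n Jn] := jrad_nilpotent A.
have [sg [sgK sgM]] := section_modulo_power n.
have mulE a b : sg (a * b) = sg a * sg b.
  by apply/esym/eqP; rewrite -subr_eq0 -memv0 -Jn sgM.
(* The element [1 - sg 1] is an idempotent of the nilpotent radical, hence zero. *)
have sg1 : sg 1 = 1.
  have idem : (1 - sg 1) * (1 - sg 1) = 1 - sg 1.
    by rewrite mulrBr mulr1 mulrBl mul1r -mulE mulr1 subrr subr0.
  have inJ m : 1 - sg 1 \in (J ^+ m.+1)%VS.
    have in1 : 1 - sg 1 \in J.
      by apply/jproj_eq0; rewrite rmorphB rmorph1 /= sgK subrr.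
    by elim: m => // m IHm; rewrite expvSl -idem memv_mul.
  by apply/esym/eqP; rewrite -subr_eq0 -memv0 -Jn.
have sg_mon : monoid_morphism sg by split.
pose sgR := GRing.isMonoidMorphism.Build (jquot A) A sg sg_mon.
pose eps : {lrmorphism jquot A -> A} := HB.pack (fun_of_lfun sg) sgR.
by exists eps.
Qed.

(** * The bimodule splitting by averaging *)

Section BimoduleSplitting.

Variable eps : {lrmorphism jquot A -> A}.
Hypothesis epsK : alg_section eps.

Local Notation J2 := (J ^+ 2)%VS.

Definition compl2 : 'End(A) := (\1 - projv J2)%VF.

Lemma compl2E x : compl2 x = x - projv J2 x.
Proof. by rewrite add_lfunE opp_lfunE id_lfunE. Qed.

(** The linear projection [compl2] along [J2], averaged over the separability idempotent on the left
    and on the right. *)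
Definition average (x : A) : A :=
  \sum_(p <- e) \sum_(q <- e)
    eps p.1 * compl2 (eps p.2 * x * eps q.1) * eps q.2.

Lemma average_is_zmod_morphism : zmod_morphism average.
Proof.
move=> x y; rewrite /average -sumrB; apply: eq_bigr => p _.
rewrite -sumrB; apply: eq_bigr => q _.
by rewrite mulrBr mulrBl linearB mulrBr mulrBl.
Qed.

HB.instance Definition _ :=
  GRing.isZmodMorphism.Build A A average average_is_zmod_morphism.

(** For fixed [q] the summand is bilinear in the entries of [p], so [eC] carries [a] from the right
    of [p.2] to the left of [p.1]. *)
Lemma averageMl a x : average (eps a * x) = eps a * average x.
Proof.
rewrite /average exchange_big [X in _ = _ * X]exchange_big mulr_sumr /=.
apply: eq_bigr => q _.
have bil : bilin (fun u v => eps u * compl2 (eps v * x * eps q.1) * eps q.2).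
  split=> [u c v v'|v c u u'].
    by rewrite linearP /= !mulrDl -!scalerAl linearP mulrDr mulrDl -scalerAr -scalerAl.
  by rewrite linearP /= !mulrDl -!scalerAl.
rewrite mulr_sumr; have /= H := eC a bil.
transitivity (\sum_(p <- e)
    eps p.1 * compl2 (eps (p.2 * a) * x * eps q.1) * eps q.2).
  by apply: eq_bigr => p _; rewrite rmorphM !mulrA.
by rewrite -H; apply: eq_bigr => p _; rewrite rmorphM !mulrA.
Qed.

Lemma averageMr a x : average (x * eps a) = average x * eps a.
Proof.
rewrite /average mulr_suml; apply: eq_bigr => p _.
have bil : bilin (fun u v => eps p.1 * compl2 (eps p.2 * x * eps u) * eps v).
  split=> [u c v v'|v c u u'].
    by rewrite linearP /= mulrDr -scalerAr.
  by rewrite linearP /= mulrDr -scalerAr linearP mulrDr mulrDl -scalerAr -scalerAl.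
rewrite mulr_suml; have /= H := eC a bil.
transitivity (\sum_(q <- e)
    eps p.1 * compl2 (eps p.2 * x * eps (a * q.1)) * eps q.2).
  by apply: eq_bigr => q _; rewrite rmorphM !mulrA.
by rewrite H; apply: eq_bigr => q _; rewrite rmorphM !mulrA.
Qed.

(** Modulo [J2] the map [compl2] is the identity, and averaging the identity returns [x] because the
    products [p.1 * p.2] add up to 1. *)
Lemma average_sub x : x \in J -> average x - x \in J2.
Proof.
move=> xJ; have eps1 : \sum_(p <- e) eps p.1 * eps p.2 = 1.
  by rewrite -(rmorph1 eps) -e1 rmorph_sum; apply: eq_bigr => p _; rewrite rmorphM.
have xE : \sum_(p <- e) \sum_(q <- e) eps p.1 * (eps p.2 * x * eps q.1) * eps q.2 = x.
  transitivity (\sum_(p <- e) eps p.1 * eps p.2 * x).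
    apply: eq_bigr => p _; rewrite -[RHS]mulr1 -eps1 mulr_sumr.
    by apply: eq_bigr => q _; rewrite !mulrA.
  by rewrite -mulr_suml eps1 mul1r.
rewrite -[X in _ - X]xE /average -sumrB; apply: rpred_sum => p _.
rewrite -sumrB; apply: rpred_sum => q _; rewrite -mulrBl -mulrBr compl2E.
rewrite addrAC subrr add0r two_sided_idealMr ?two_sided_idealMl ?jrad2_ideal //.
by rewrite memvN memv_proj.
Qed.

Lemma average_jrad x : x \in J -> average x \in J.
Proof.
move=> xJ; rewrite -[average x](subrK x) rpredD //.
exact: (subvP (jrad2_sub A)) (average_sub xJ).
Qed.

Lemma average_jrad2 x : x \in J2 -> average x = 0.
Proof.
move=> xJ2; rewrite /average big1 // => p _; rewrite big1 // => q _.
rewrite compl2E projv_id ?subrr ?mulr0 ?mul0r //.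
by rewrite two_sided_idealMr ?two_sided_idealMl ?jrad2_ideal.
Qed.

Lemma rad_sequence_splits :
  ses_splits (rad2_incl (eps := eps)) (rad_proj (eps := eps)).
Proof.
split; first exact: rad_short_exact.
(* The chosen representative is immaterial, as [average] vanishes on [J2]. *)
pose s (u : rad_quo_bimod eps) : rad_bimod eps :=
  Subvs (average_jrad (subvsP (repr u : subvs_of J))).
have sE x : vsval (s (rad_proj (eps := eps) x) : subvs_of J) =
    average (vsval (x : subvs_of J)).
  rewrite -[LHS]/(average (vsval (repr (ideal_proj J2 x) : subvs_of J))).
  apply/eqP; rewrite -subr_eq0 -raddfB /=; apply/eqP/average_jrad2.
  by apply/ideal_proj_eq; rewrite ideal_proj_repr.
have proj_surj u : exists x, u = rad_proj (eps := eps) x.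
  by exists (repr u); rewrite [RHS]ideal_proj_repr.
have [_ [pD pl pr] _ _ _] := rad_short_exact eps.
exists s; last first.
  move=> u; have [x ->] := proj_surj u; apply/ideal_proj_eq.
  by rewrite -/(rad_proj _) sE average_sub ?subvsP.
split=> [u v|a u|u a].
- have [x ->] := proj_surj u; have [y ->] := proj_surj v.
  rewrite -pD; apply: val_inj; apply: (etrans (sE _)).
  by apply: (etrans (raddfD average _ _)); congr (_ + _); apply/esym/sE.
- have [x ->] := proj_surj u; rewrite -pl; apply: val_inj.
  apply: (etrans (sE _)); apply: (etrans (averageMl _ _)).
  by congr (_ * _); apply/esym/sE.
- have [x ->] := proj_surj u; rewrite -pr; apply: val_inj.
  apply: (etrans (sE _)); apply: (etrans (averageMr _ _)).
  by congr (_ * _); apply/esym/sE.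
Qed.

End BimoduleSplitting.
End Lifting.

Theorem proposition3p10 (k : fieldType) (A : falgType k) :
  perfect k -> basic A -> rad_split A.
Proof.
move=> perfk _.
have [e [e1 eC]] := separability_idempotent (@jquot_semiprime k A) perfk.
split; first exact: (split_of_separable e1 eC).
by move=> eps _; apply: (rad_sequence_splits e1 eC).
Qed.
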